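(* Let $G$ be a graph of order $n$ without isolated vertices. Then $$\gamma_g(G)\le \frac{2n}{3}\qquad\text{and}\qquad \gamma_g'(G)\le \frac{2n}{3}.$$
   Context: Graphs are finite, simple and undirected; the order of $G=(V,E)$ is $|V|$. For $v\in V$, $N(v)=\{u: uv\in E\}$ and $N[v]=N(v)\cup\{v\}$; for $S\subseteq V$, $N[S]=\bigcup_{v\in S}N[v]$ is the set of vertices dominated by $S$. The domination game on $G$: two players, Dominator and Staller, alternately select a vertex of $G$. If $D$ is the set of vertices selected so far (by both players), then selecting $v$ is legal if and only if it dominates at least one new vertex, i.e. $N[v]\not\subseteq N[D]$. The game ends when no legal move exists, equivalently when $N[D]=V$. The length of the game is the total number of vertices selected (the number of turns, a turn being one move of one player). Dominator wants to minimize the length and Staller wants to maximize it. The game domination number $\gamma_g(G)$ is the length of the game when Dominator makes the first move and both players play optimally. The Staller-start game domination number $\gamma_g'(G)$ is the length of the game when Staller makes the first move and both players play optimally. *)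

(* Defs.v *)
From mathcomp Require Import all_boot.

Set Implicit Arguments.
Unset Strict Implicit.
Unset Printing Implicit Defensive.

(* A finite simple graph is a finType of vertices with a symmetric and
   irreflexive adjacency relation [e]; the hypotheses on [e] are stated where
   they are needed. *)

Section DominationGame.

Variables (T : finType) (e : rel T).
Implicit Types (D : {set T}) (u v : T).

Definition open_nbhd v : {set T} := [set u | e v u].

Definition closed_nbhd v : {set T} := v |: open_nbhd v.

Definition dominated D : {set T} := \bigcup_(v in D) closed_nbhd v.

Definition isolated v : bool := open_nbhd v == set0.

Definition legal D v : bool := ~~ (closed_nbhd v \subset dominated D).

Inductive player := Dominator | Staller.

Definition opponent p := if p is Dominator then Staller else Dominator.

(* The value [F v] of a move [v] that player [p] prefers among the moves
   satisfying [P], one of which is [v0]. *)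
Definition best p (P : pred T) (F : T -> nat) v0 : nat :=
  match p with
  | Dominator => F [arg min_(v < v0 | P v) F v]
  | Staller => F [arg max_(v > v0 | P v) F v]
  end.

(* Backward induction; [k] only bounds the recursion depth. *)
Fixpoint length_rec k p D : nat :=
  if k is k'.+1 then
    if [pick v | legal D v] is Some v0 then
      (best p (legal D) (fun v => length_rec k' (opponent p) (v |: D)) v0).+1
    else 0
  else 0.

(* Number of moves still to be played, under optimal play, when [D] is the set
   of vertices selected so far and [p] is to move. A legal move is never in [D],
   so at most [#|~: D|] moves remain: see [game_lengthE]. *)
Definition game_length p D : nat := length_rec #|~: D| p D.

Definition game_dom : nat := game_length Dominator set0.

Definition game_dom_Staller : nat := game_length Staller set0.

Lemma legal_notin D v : legal D v -> v \notin D.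
Proof. by apply: contra => vD; apply: bigcup_sup. Qed.

Lemma game_overP D : reflect (forall v, ~~ legal D v) (dominated D == setT).
Proof.
apply: (iffP eqP) => [domT v|over]; first by rewrite negbK domT subsetT.
apply/setP=> v; rewrite inE; have := over v; rewrite negbK => /subsetP.
by apply; rewrite setU11.
Qed.

Lemma eq_best p (P : pred T) (F G : T -> nat) v0 : P v0 ->
  (forall v, P v -> F v = G v) -> best p P F v0 = best p P G v0.
Proof.
move=> Pv0 eqFG; case: p => /=; apply/eqP; rewrite eqn_leq.
  case: arg_minnP => // v Pv minF; case: arg_minnP => // w Pw minG.
  by apply/andP; split; [rewrite -eqFG //; apply: minF | rewrite eqFG //; apply: minG].
case: arg_maxnP => // v Pv maxF; case: arg_maxnP => // w Pw maxG.
by apply/andP; split; [rewrite eqFG //; apply: maxG | rewrite -eqFG //; apply: maxF].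
Qed.

Lemma length_rec_fuel k p D : #|~: D| <= k -> length_rec k p D = game_length p D.
Proof.
have full l D' v : #|~: D'| <= l -> l = 0 -> legal D' v = false.
  move=> + l0; rewrite {}l0 leqn0 cards_eq0 => /eqP/setP/(_ v).
  by rewrite !inE => /negbFE vD'; apply: contraTF vD' => /legal_notin.
suff eq_rec l : #|~: D| <= l -> #|~: D| <= k -> length_rec k p D = length_rec l p D.
  by move=> leDk; apply: eq_rec.
elim: k l p D => [|k IHk] [|l] p D leDl leDk //=.
- by case: pickP => // v; rewrite (full _ _ _ leDk).
- by case: pickP => // v; rewrite (full _ _ _ leDl).
case: pickP => // v0 legv0; congr _.+1; apply: eq_best => // v /legal_notin vD.
have lt : #|~: (v |: D)| < #|~: D|.
  by rewrite setCU setIC -setDE [ltnRHS](cardsD1 v) inE vD.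
by apply: IHk; rewrite -ltnS (leq_trans lt).
Qed.

Lemma game_lengthE p D :
  game_length p D =
    if [pick v | legal D v] is Some v0 then
      (best p (legal D) (fun v => game_length (opponent p) (v |: D)) v0).+1
    else 0.
Proof.
rewrite -(@length_rec_fuel #|~: D|.+1) //=.
case: pickP => // v0 legv0; congr _.+1; apply: eq_best => // v /legal_notin vD.
apply: length_rec_fuel; apply: subset_leq_card.
by rewrite setCS subsetUr.
Qed.

End DominationGame.

(* Main.v *)
Require Import Defs.
From mathcomp Require Import all_boot all_order all_algebra.
From mathcomp Require Import zify.
Import Order.TTheory GRing.Theory Num.Theory.
Local Open Scope ring_scope.

(** Give weight 2 to an undominated vertex, weight 1 to a dominated vertex with
    an undominated neighbor, and weight 0 to the others.  The last two kinds
    differ in whether the vertex is still a legal move, so the total weight of a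
    position is the number of undominated vertices plus the number of legal
    moves.  It is 2n at the start, and it suffices that moves lower it by 3 on
    average.

    Every move lowers the weight by at least 2 ([weight_move_ge2]): the selected
    vertex stops being legal, and some vertex becomes dominated.  As long as
    some move dominates two new vertices, Dominator has a move that lowers the
    weight by at least 4 ([Dominator_good_move]), which makes up for Staller's
    reply.  Once every move dominates at most one new vertex, the closed
    neighborhoods of the undominated vertices are pairwise disjoint sets of
    legal moves, each with at least two elements; the weight is then at least
    three times the number of undominated vertices ([weight_endgame]), which
    bounds the number of remaining moves, whoever plays
    ([game_length_le_undominated]).  Hence the number of remaining moves is at
    most W / 3 when Dominator is to move at weight W, and at most (W + 1) / 3
    when Staller is ([game_length_weight]).  If Staller starts, the first move
    already lowers the weight by 3, since it dominates at least two vertices. *)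

Section Weight.

Set Implicit Arguments.
Unset Strict Implicit.
Unset Printing Implicit Defensive.

Variables (T : finType) (e : rel T).
Implicit Types (D : {set T}) (u v x y z : T) (p : player).

Local Notation N := (closed_nbhd e).

Local Open Scope nat_scope.

Definition undominated D : {set T} := ~: dominated e D.

Definition legal_moves D : {set T} := [set v | legal e D v].

Definition weight D := #|undominated D| + #|legal_moves D|.

Definition newly_dominated D v : {set T} := N v :&: undominated D.

(** The moves that selecting [v] makes illegal. *)
Definition settled D v : {set T} :=
  [set x in legal_moves D | newly_dominated D x \subset newly_dominated D v].

Lemma closed_nbhd_refl v : v \in N v.
Proof. exact: setU11. Qed.

Lemma closed_nbhd_sym (e_sym : symmetric e) u v : (u \in N v) = (v \in N u).
Proof. by rewrite !inE e_sym eq_sym. Qed.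

Lemma card_closed_nbhd (e_irr : irreflexive e) v :
  ~~ isolated e v -> 2 <= #|N v|.
Proof.
move=> v_iso; rewrite cardsU1 inE e_irr ltnS card_gt0.
exact: v_iso.
Qed.

Lemma mem_newly_dominated D v x :
  (x \in newly_dominated D v) = (x \in N v) && (x \in undominated D).
Proof. exact: in_setI. Qed.

Lemma legalE D v : legal e D v = (newly_dominated D v != set0).
Proof. by rewrite /legal /newly_dominated -setDE setD_eq0. Qed.

Lemma newly_dominated_legal D v x :
  x \in newly_dominated D v -> v \in legal_moves D.
Proof. by move=> xv; rewrite inE legalE; apply/set0Pn; exists x. Qed.

Lemma undominated_move D v :
  undominated (v |: D) = undominated D :\: newly_dominated D v.
Proof.
apply/setP=> x; rewrite /newly_dominated /undominated /dominated.
rewrite bigcup_setU big_set1 !inE.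
by case: (x == v); case: (e v x); case: (x \in _).
Qed.

Lemma newly_dominated_move D v x :
  newly_dominated (v |: D) x = newly_dominated D x :\: newly_dominated D v.
Proof. by rewrite /newly_dominated undominated_move setIDA. Qed.

Lemma legal_moves_move D v :
  legal_moves (v |: D) = legal_moves D :\: settled D v.
Proof.
apply/setP=> x; rewrite !inE !legalE newly_dominated_move setD_eq0.
case: (boolP (_ \subset _)) => /= [|nsub]; first by rewrite andbT andNb.
by rewrite andbF /=; apply/esym; apply: contraNneq nsub => ->; apply: sub0set.
Qed.

Lemma weight_move D v :
  weight (v |: D) + #|newly_dominated D v| + #|settled D v| = weight D.
Proof.
have subU : newly_dominated D v \subset undominated D by apply: subsetIr.
have subL : settled D v \subset legal_moves D.
  by apply/subsetP=> x; rewrite inE => /andP[].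
rewrite /weight undominated_move legal_moves_move.
have := cardsDS subU; have := cardsDS subL.
have := subset_leq_card subU; have := subset_leq_card subL.
lia.
Qed.

Lemma settled_refl D v : legal e D v -> v \in settled D v.
Proof. by move=> leg; rewrite !inE leg subxx. Qed.

Lemma weight_move_newly D v : legal e D v ->
  weight (v |: D) + #|newly_dominated D v| < weight D.
Proof.
move=> leg; rewrite -(weight_move D v) -addn1 leq_add2l card_gt0.
by apply/set0Pn; exists v; apply: settled_refl.
Qed.

Lemma weight_move_ge2 D v : legal e D v -> weight (v |: D) + 2 <= weight D.
Proof.
move=> leg; have := weight_move_newly leg.
by move: leg; rewrite legalE -card_gt0; lia.
Qed.

(** A move that dominates three new vertices is good.  If there is none, a move
    that dominates [x] and [y] is good when it settles both of them.  Otherwise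
    one of the two, say [x], has an undominated neighbor [z] outside the pair;
    then [x] and [z] are each other's only undominated neighbor, and selecting
    [x] settles both. *)
Lemma Dominator_good_move (e_sym : symmetric e) D v0 :
    2 <= #|newly_dominated D v0| ->
  exists2 v, legal e D v & weight (v |: D) + 4 <= weight D.
Proof.
move=> v0_ge2.
(* Two distinct settled vertices suffice, as two vertices get dominated. *)
have two v x y : x != y -> [set x; y] \subset settled D v ->
    2 <= #|newly_dominated D v| ->
    exists2 v, legal e D v & weight (v |: D) + 4 <= weight D.
  move=> xy /subset_leq_card; rewrite cards2 xy => settled2 new2; exists v.
    by rewrite legalE -card_gt0; lia.
  by have := weight_move D v; lia.
have [[v v_ge3]|le2] : (exists v, 3 <= #|newly_dominated D v|) \/
    (forall v, #|newly_dominated D v| <= 2).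
  case: (boolP [exists v, 3 <= #|newly_dominated D v|]) => [/existsP|]; first by left.
  by rewrite negb_exists => /forallP h; right=> v; rewrite leqNgt.
  have leg : legal e D v by rewrite legalE -card_gt0; lia.
  by exists v => //; have := weight_move_newly leg; lia.
have pairE a b v : a != b -> a \in newly_dominated D v ->
    b \in newly_dominated D v -> newly_dominated D v = [set a; b].
  move=> ab av bv; apply/esym/eqP; rewrite eqEcard cards2 ab le2 andbT.
  by rewrite subUset !sub1set av.
have mem_self x v : x \in newly_dominated D v -> x \in newly_dominated D x.
  by rewrite !mem_newly_dominated closed_nbhd_refl => /andP[].
have [x [y [xv yv xy]]] : exists x y, [/\ x \in newly_dominated D v0,
    y \in newly_dominated D v0 & x != y] by apply/card_gt1P.
have adjacent w z : w \in newly_dominated D w -> z \in newly_dominated D w ->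
    w != z -> exists2 v, legal e D v & weight (v |: D) + 4 <= weight D.
  move=> ww zw wz; have zz := mem_self _ _ zw.
  have wz' : w \in newly_dominated D z.
    rewrite mem_newly_dominated closed_nbhd_sym //.
    by move: zw ww; rewrite !mem_newly_dominated => /andP[-> _] /andP[_ ->].
  have Ew := pairE _ _ _ wz ww zw; have Ez := pairE _ _ _ wz wz' zz.
  apply: (two w w z wz); last by rewrite Ew cards2 wz.
  apply/subsetP=> t; rewrite [t \in settled _ _]inE => /set2P[]->.
    by rewrite (newly_dominated_legal ww) subxx.
  by rewrite (newly_dominated_legal zz) Ew Ez subxx.
have xx := mem_self _ _ xv; have yy := mem_self _ _ yv.
have settles w : w \in newly_dominated D v0 -> w \in newly_dominated D w ->
    w \in settled D v0 \/
    exists2 v, legal e D v & weight (v |: D) + 4 <= weight D.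
  move=> wv ww; case: (boolP (w \in settled D v0)) => [|nset]; [by left | right].
  move: nset; rewrite inE (newly_dominated_legal ww) /= => /subsetPn[z zw zv].
  by apply: (adjacent w z) => //; apply: contraNneq zv => <-.
case: (settles x xv xx) => // sx; case: (settles y yv yy) => // sy.
by apply: (two v0 x y) => //; rewrite subUset !sub1set sx.
Qed.

(** Double counting of the pairs formed by an undominated vertex and a move
    that dominates it. *)
Lemma weight_endgame (e_sym : symmetric e) (e_irr : irreflexive e)
    (no_isolated : forall v, ~~ isolated e v) D :
    (forall v, #|newly_dominated D v| <= 1) ->
  3 * #|undominated D| <= weight D.
Proof.
move=> le1.
have -> : 3 * #|undominated D| = #|undominated D| + 2 * #|undominated D| by lia.
rewrite leq_add2l.
have le_sum : 2 * #|undominated D| <= \sum_(x in undominated D) #|N x|.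
  by rewrite mulnC -sum_nat_const; apply: leq_sum => x _; apply: card_closed_nbhd.
apply: leq_trans le_sum _.
have -> : \sum_(x in undominated D) #|N x| = \sum_v #|newly_dominated D v|.
  under eq_bigr => x _ do rewrite -sum1_card.
  rewrite (exchange_big_dep xpredT) //=; apply: eq_bigr => v _.
  rewrite -sum1_card; apply: eq_bigl => x.
  by rewrite mem_newly_dominated closed_nbhd_sym // andbC.
rewrite -sum1_card [leqRHS]big_mkcond /=; apply: leq_sum => v _.
rewrite inE legalE; case: eqP => [->|_]; first by rewrite cards0.
exact: le1.
Qed.

Lemma game_length_Dominator_le D v : legal e D v ->
  game_length e Dominator D <= (game_length e Staller (v |: D)).+1.
Proof.
move=> leg; rewrite game_lengthE; case: pickP => //= v0 leg0.
by rewrite ltnS; case: arg_minnP => // w _; apply.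
Qed.

Lemma game_length_le p D m :
    (forall v, legal e D v -> game_length e (opponent p) (v |: D) < m) ->
  game_length e p D <= m.
Proof.
move=> bound; rewrite game_lengthE; case: pickP => //= v0 leg0.
case: p bound => /= bound.
  by case: arg_minnP => // w legw _; apply: bound.
by case: arg_maxnP => // w legw _; apply: bound.
Qed.

Lemma undominated_move_lt D v : legal e D v ->
  #|undominated (v |: D)| < #|undominated D|.
Proof.
rewrite legalE -card_gt0 undominated_move => new_gt0.
have subU : newly_dominated D v \subset undominated D by apply: subsetIr.
by have := cardsDS subU; have := subset_leq_card subU; lia.
Qed.

Lemma game_length_le_undominated p D : game_length e p D <= #|undominated D|.
Proof.
have [k] := ubnP #|undominated D|; elim: k p D => // k IHk p D leD.
apply: game_length_le => v /undominated_move_lt lt.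
by apply: (leq_ltn_trans _ lt); apply: IHk; apply: leq_trans lt _.
Qed.

(** The extra unit on Staller's side is what Dominator gains by a move that
    lowers the weight by 4 instead of 3, and what Staller takes back by a move
    that lowers it by only 2. *)
Theorem game_length_weight (e_sym : symmetric e) (e_irr : irreflexive e)
    (no_isolated : forall v, ~~ isolated e v) D :
  3 * game_length e Dominator D <= weight D /\
  3 * game_length e Staller D <= weight D + 1.
Proof.
have [k] := ubnP (weight D); elim: k D => // k IHk D ltDk; split.
  have [|le1] := boolP [exists v, 2 <= #|newly_dominated D v|].
    case/existsP=> v0 /(Dominator_good_move e_sym)[v leg drop].
    have [|_ bound] := IHk (v |: D); first by lia.
    by have := game_length_Dominator_le leg; lia.
  have end_weight : 3 * #|undominated D| <= weight D.
    apply: weight_endgame => // v; rewrite leqNgt.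
    by move: le1; rewrite negb_exists => /forallP.
  by have := game_length_le_undominated Dominator D; lia.
suff : game_length e Staller D <= (weight D + 1) %/ 3 by lia.
apply: game_length_le => v /weight_move_ge2 drop /=.
by have [|bound _] := IHk (v |: D); lia.
Qed.

Lemma newly_dominated_start v : newly_dominated set0 v = N v.
Proof. by rewrite /newly_dominated /undominated /dominated big_set0 setC0 setIT. Qed.

Lemma weight_start_le : weight set0 <= 2 * #|T|.
Proof. by rewrite /weight mul2n -addnn leq_add ?max_card. Qed.

End Weight.

Theorem proposition1 (T : finType) (e : rel T)
    (e_sym : symmetric e) (e_irr : irreflexive e)
    (no_isolated : forall v : T, ~~ isolated e v) :
  (game_dom e)%:R <= 2 * #|T|%:R / 3 :> rat /\
  (game_dom_Staller e)%:R <= 2 * #|T|%:R / 3 :> rat.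
Proof.
have third m : (3 * m <= weight e set0)%N -> m%:R <= 2 * #|T|%:R / 3 :> rat.
  move=> le_m; rewrite ler_pdivlMr // -!natrM ler_nat mulnC.
  exact: leq_trans le_m (weight_start_le e).
split; apply: third.
  by have [] := game_length_weight e_sym e_irr no_isolated set0.
suff : (game_dom_Staller e <= weight e set0 %/ 3)%N by lia.
apply: game_length_le => v leg /=.
have [bound _] := game_length_weight e_sym e_irr no_isolated (v |: set0).
have := weight_move_newly leg; rewrite newly_dominated_start.
have := card_closed_nbhd e_irr (no_isolated v).
by lia.
Qed.
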